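(* Let $m$, $r$, $s$ and $a>1$ be positive integers such that $sa/(rm^{2})$ is an integer. Then the following hold. (1) If $m>1$ and $sa/(rm^{2})>1$, then $$\left[0;\overline{m-1,1,\frac{sa^{k}}{rm^2}-1,m-1,1,a^{k}-1}\,\right]_{k=1}^{\infty}=\frac{1}{m}+\frac{\sum_{n=0}^{\infty}\frac{(r/s)^{n+1}}{a^{(n+1)^{2}}(1/a;1/a)_{n}}}{\sum_{n=0}^{\infty}\frac{(r/s)^{n}}{a^{n^{2}+n}(1/a;1/a)_{n}}}.$$ (2) If $m>2$ and $sa/(rm^{2})>1$, then $$\left[1;\overline{m,\frac{sa^{k}}{rm^2}-1,1,m-2,1,a^{k}-1}\,\right]_{k=1}^{\infty}=\frac{1}{m}+\frac{\sum_{n=0}^{\infty}\frac{(-r/s)^{n}}{a^{n^{2}}(1/a;1/a)_{n}}}{\sum_{n=0}^{\infty}\frac{(-r/s)^{n}}{a^{n^{2}+n}(1/a;1/a)_{n}}}.$$ (3) If $m>2$ and $sa/(rm^{2})>1$, then $$\left[0;\overline{1,m-2,1,\frac{sa^{k}}{rm^2}-1,m,a^{k}-1}\,\right]_{k=1}^{\infty}=\frac{-1}{m}+\frac{\sum_{n=0}^{\infty}\frac{(-r/s)^{n}}{a^{n^{2}}(1/a;1/a)_{n}}}{\sum_{n=0}^{\infty}\frac{(-r/s)^{n}}{a^{n^{2}+n}(1/a;1/a)_{n}}}.$$ (4) If $m>2$ and $sa/(rm^{2})>1$, then $$\left[1;\overline{m,\frac{sa^{2k-1}}{rm^2}-1,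1,m-1,a^{2k-1}-1,1,m-2,1,\frac{sa^{2k}}{rm^2}-1,m-1,1,a^{2k}-1}\,\right]_{k=1}^{\infty}=\frac{1}{m}+\frac{\sum_{n=0}^{\infty}\frac{(-r/s)^{n}}{a^{n^{2}}(-1/a;-1/a)_{n}}}{\sum_{n=0}^{\infty}\frac{(r/s)^{n}}{a^{n^{2}+n}(-1/a;-1/a)_{n}}}.$$
   Context: $[a_0;a_1,a_2,\ldots]$ denotes the (value of the) infinite regular continued fraction $a_0+\cfrac{1}{a_1+\cfrac{1}{a_2+\cdots}}$. The notation $[a_0;\overline{f_1(k),\ldots,f_r(k)}\,]_{k=1}^{\infty}$ means that after $a_0$ the partial quotients are $f_1(1),\ldots,f_r(1),f_1(2),\ldots,f_r(2),f_1(3),\ldots$, i.e. the blocks $f_1(k),\ldots,f_r(k)$ for $k=1,2,3,\ldots$ concatenated in order. For complex $x,q$: $(x;q)_0:=1$ and $(x;q)_n:=\prod_{j=0}^{n-1}(1-xq^{j})$ for $n\ge 1$. *)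

(* Defs.v *)
From mathcomp Require Import all_boot all_order all_algebra.
From mathcomp Require Import all_classical all_reals all_analysis.

Set Implicit Arguments.
Unset Strict Implicit.
Unset Printing Implicit Defensive.

Import Order.TTheory GRing.Theory Num.Theory.
Import numFieldNormedType.Exports.

Local Open Scope classical_set_scope.
Local Open Scope ring_scope.

(* The q-Pochhammer symbol (x; q)_n. *)
Definition qpoch (K : comNzRingType) (x q : K) (n : nat) : K :=
  \prod_(j < n) (1 - x * q ^+ j).

(* The finite continued fraction [u 0; u 1, ..., u n]. *)
Fixpoint cf_convergent (K : fieldType) (u : nat -> int) (n : nat) : K :=
  if n is n'.+1 then (u 0%N)%:~R + (cf_convergent K (fun i => u i.+1) n')^-1
  else (u 0%N)%:~R.

(* [u 0; u 1, u 2, ...] is a regular continued fraction with value x: besides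
   convergence to x, the integers u i with i >= 1 are required to be positive,
   so that no convergent involves an inverse of 0. *)
Definition is_regular_cf (R : realType) (u : nat -> int) (x : R) : Prop :=
  (forall i, 0 < u i.+1) /\ cf_convergent R u n @[n --> \oo] --> x.

(* The sequence a0, B 1, B 2, B 3, ... obtained by concatenating the blocks
   B k of length r; B 0 is not used. *)
Definition block_seq (r : nat) (a0 : int) (B : nat -> r.-tuple int)
    (i : nat) : int :=
  if i is j.+1 then nth 0 (B (j %/ r).+1) (j %% r) else a0.

(* Main.v *)
Require Import Defs.
From mathcomp Require Import all_boot all_order all_algebra.
From mathcomp Require Import all_classical all_reals all_analysis.
From mathcomp Require Import ring lra zify.

Set Implicit Arguments.
Unset Strict Implicit.
Unset Printing Implicit Defensive.

Import Order.TTheory GRing.Theory Num.Theory.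
Import numFieldNormedType.Exports.

Local Open Scope classical_set_scope.
Local Open Scope ring_scope.

(** Put F_p(x) = sum_n p^(n^2) x^n / (p;p)_n, the Rogers-Ramanujan series with
    base p.  It satisfies F(x) = F(xp) + xp F(xp^2), so that the quotients
      w_k = x p^k F(x p^(2k)) / F(x p^(2k-1)),  k >= 1,
    obey the recursion
      w_k = 1 / (1/(x p^k) + 1/(1/p^k + w_(k+1)))          (rr_quot_rec).
    Write c = r/s and q = 1/a.  The right-hand sides of the four identities are
    an integer plus 1/m + w_1 or 1 - 1/m + w_1, where x = c or -c and p = q or
    -q: in the first identity N/D is w_1 itself, in the others
    N/D = F(x)/F(xp) = 1 + w_1 (rr_ratio).  In the fourth one p = -q, and the
    signs of the powers of -q turn the series of the statement into F.

    On the continued fraction side, the partial quotients of a block can be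
    eliminated one pair at a time with two rules:
      1/(1 + 1/(y - 1)) = 1 - 1/y   and
      1/(m - 1/(v + 1/m)) = 1/m + 1/(m^2 v).
    Up to a shift by 1/m, the second is the map v |-> 1/(m^2 v).
    A whole block applied to the tail 1/m + w then becomes
      1/m + 1/(m^2 X + 1/(Y + w))
    up to signs (block1_fold to block4_fold), and m^2 X_k = a^k / c, so this is
    exactly the recursion of the w_k.  Hence the numbers z_k = 1/m + w_k (or
    1 - 1/m + w_k) are the tails of the continued fraction at the block
    boundaries.

    The relations between the tails determine the value because the tails are
    nonnegative (regular_cf_blocks): then all of them lie in [0, 1], and a
    convergent differs from the value by a truncated tail, whose influence
    decays geometrically (cf_tail_contract).  Nonnegativity comes from crude
    bounds: the hypothesis s a / (r m^2) > 1 gives |xp| <= 1/(2 m^2) <= 1/8,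
    there F is within 1/7 of 1 (rr_fun_near1), and so |w_k| <= 1/m. *)

(** * Convergence of regular continued fractions with known tails *)

(** The real t is added to the last partial quotient u n, so a truncation is
    the case t = 0 and a fractional tail lies in [0, 1]. *)
Fixpoint cf_tail (R : realType) (u : nat -> int) (n : nat) (t : R) : R :=
  if n is n'.+1 then (u 0%N)%:~R + (cf_tail (fun i => u i.+1) n' t)^-1
  else (u 0%N)%:~R + t.

Lemma cf_convergent_tail (R : realType) (u : nat -> int) (n : nat) :
  cf_convergent R u n = cf_tail u n 0.
Proof. by elim: n u => [|n IH] u /=; rewrite ?addr0 ?IH. Qed.

Lemma int_ge1 (R : realType) (b : int) : 0 < b -> 1 <= b%:~R :> R.
Proof. by move=> b0; rewrite -[1]/(1%:~R) ler_int -gtz0_ge1. Qed.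

Lemma cf_tail_ge1 (R : realType) (u : nat -> int) (n : nat) (t : R) :
  (forall i, 0 < u i) -> 0 <= t -> 1 <= cf_tail u n t.
Proof.
elim: n u => [|n IH] u u_gt0 t_ge0 /=; have u1 := int_ge1 R (u_gt0 0%N).
  by lra.
have : 0 <= (cf_tail (fun i => u i.+1) n t)^-1.
  by rewrite invr_ge0 (le_trans ler01)// IH.
by lra.
Qed.

(** Two levels of the fraction act on a tail T >= 1 as T |-> u + 1/(b + 1/T)
    with b >= 1.  The difference of two images is the difference of the tails
    divided by (b T + 1) (b T' + 1) >= 4, which gives a factor 1/2 per level.
    The induction goes by steps of two because T |-> u + 1/T alone need not be
    contracting near T = 1. *)
Lemma cf_tail_contract (R : realType) (u : nat -> int) (n : nat) (t t' : R) :
  (forall i, 0 < u i.+1) -> 0 <= t <= 1 -> 0 <= t' <= 1 ->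
  `|cf_tail u n t - cf_tail u n t'| <= 2 * 2^-1 ^+ n.
Proof.
move=> u_gt0 ht ht'.
elim/ltn_ind: n u u_gt0 => -[|[|n]] IH u u_gt0 /=.
- by rewrite expr0 ler_norml; lra.
- have u1 := int_ge1 R (u_gt0 0%N).
  set b := _%:~R in u1 *.
  have b0 y : 0 <= y <= 1 -> 0 <= (b + y)^-1 <= 1.
    move=> hy; rewrite invr_ge0 invf_le1; lra.
  by rewrite expr1 ler_norml; move: (b0 _ ht) (b0 _ ht'); lra.
have u1 := int_ge1 R (u_gt0 0%N).
set b := (u 1%N)%:~R in u1 *.
pose v i := u i.+2; have v_gt0 i : 0 < v i by exact: u_gt0.
have := IH n (leqnSn n.+1) v (fun i => v_gt0 i.+1).
have : 1 <= cf_tail v n t by apply: cf_tail_ge1 => //; case/andP: ht.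
have : 1 <= cf_tail v n t' by apply: cf_tail_ge1 => //; case/andP: ht'.
rewrite -/v; set T := cf_tail v n t; set T' := cf_tail v n t' => T'1 T1 hT.
have bT : 1 <= b * T by rewrite mulr_ege1.
have bT' : 1 <= b * T' by rewrite mulr_ege1.
have -> : (u 0)%:~R + (b + T^-1)^-1 - ((u 0)%:~R + (b + T'^-1)^-1) =
          (T - T') / ((b * T + 1) * (b * T' + 1)).
  field; repeat (apply/andP; split); apply/eqP; lra.
rewrite normrM normfV (@ger0_norm _ (_ * _)); last by apply: mulr_ge0; lra.
rewrite ler_pdivrMr; last by apply: mulr_gt0; lra.
have h4 : 4 <= (b * T + 1) * (b * T' + 1) by nra.
rewrite 2!exprS; set e := 2^-1 ^+ n in hT *.
have e0 : 0 <= e by rewrite exprn_ge0// invr_ge0.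
nra.
Qed.

(** The value equals [u 0; u 1, ..., u n + T n] for every n, and the n-th
    convergent is the same expression with T n replaced by 0. *)
Lemma regular_cf_complete_quotients (R : realType) (u : nat -> int)
    (T : nat -> R) :
  (forall i, 0 < u i.+1) -> (forall i, 0 <= T i) ->
  (forall i, T i = ((u i.+1)%:~R + T i.+1)^-1) ->
  is_regular_cf u ((u 0%N)%:~R + T 0%N).
Proof.
move=> u_gt0 T_ge0 TE; split=> //.
have T01 i : 0 <= T i <= 1.
  rewrite T_ge0 TE invf_le1;
    have := int_ge1 R (u_gt0 i); have := T_ge0 i.+1; lra.
have xE n : (u 0%N)%:~R + T 0%N = cf_tail u n (T n).
  elim: n u T TE {u_gt0 T_ge0 T01} => [//|n IH] u T TE /=.
  by rewrite TE (IH (fun i => u i.+1) (fun i => T i.+1)).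
apply/cvgrPdist_le => e e0.
have : (fun n => 2 * 2^-1 ^+ n) @ \oo --> (0 : R).
  rewrite -[0](mulr0 2); apply: cvgMr; apply: cvg_expr.
  by rewrite ger0_norm ?invr_ge0// invf_lt1// ltr1n.
move/cvgrPdist_le => /(_ e e0); apply: filterS => n.
rewrite sub0r normrN => he.
rewrite (xE n) cf_convergent_tail.
apply: le_trans (cf_tail_contract n u_gt0 (T01 n) _) _.
  by rewrite lexx ler01.
exact: le_trans (ler_norm _) he.
Qed.

Definition cf_cons (R : realType) (b : int) (t : R) : R := (b%:~R + t)^-1.

(** It suffices to know the tails at the block boundaries: inside a block the
    tails are obtained by prepending the last entries of the block to the tail
    z of the next boundary. *)
Lemma regular_cf_blocks (R : realType) (r : nat) (a0 : int)
    (B : nat -> r.-tuple int) (z : nat -> R) :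
  (0 < r)%N -> (forall k, all (fun b => 0 < b) (B k.+1)) ->
  (forall k, 0 <= z k) ->
  (forall k, z k = foldr (@cf_cons R) (z k.+1) (B k.+1)) ->
  is_regular_cf (block_seq a0 B) (a0%:~R + z 0%N).
Proof.
move=> r_gt0 B_gt0 z_ge0 zE.
pose T i := foldr (@cf_cons R) (z (i %/ r).+1)
                  (drop (i %% r) (B (i %/ r).+1)).
have -> : z 0%N = T 0%N by rewrite zE /T div0n mod0n drop0.
apply: regular_cf_complete_quotients => [i|i|i].
- apply: (allP (B_gt0 (i %/ r)%N)); apply: mem_nth.
  by rewrite size_tuple ltn_mod.
- rewrite /T; have : all (fun b => 0 < b) (drop (i %% r) (B (i %/ r).+1)).
    by apply/allP => b /mem_drop; apply: (allP (B_gt0 (i %/ r)%N)).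
  elim: (drop _ _) => [_|b l IH /=]; first exact: z_ge0.
  move=> /andP[b0 /IH h].
  by rewrite invr_ge0 addr_ge0// ler0z ltW.
rewrite {1}/T (drop_nth 0) ?size_tuple ?ltn_mod//= /cf_cons; congr ((_ + _)^-1).
rewrite /T modnS divnS //.
(* Either i is the last position of its block, or i.+1 is in the same one. *)
case: ifP => [dv|ndv] /=.
  have -> : (i %% r).+1 = r.
    apply/eqP; rewrite eqn_leq ltn_mod r_gt0 /=.
    apply: dvdn_leq => //; move: dv.
    by rewrite {1}(divn_eq i r) -addnS dvdn_addr ?dvdn_mull.
  by rewrite drop_oversize ?size_tuple// drop0 add1n -zE.
by rewrite add0n.
Qed.

(** * The Rogers-Ramanujan series *)

Definition rr_term (R : realType) (p x : R) (n : nat) : R :=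
  p ^+ (n ^ 2) * x ^+ n / qpoch p p n.

Definition rr_fun (R : realType) (p x : R) : R := limn (series (rr_term p x)).

Lemma qpochS (K : comNzRingType) (x q : K) n :
  qpoch x q n.+1 = qpoch x q n * (1 - x * q ^+ n).
Proof. by rewrite /qpoch big_ord_recr. Qed.

Lemma norm_exprS_half (R : realType) (p : R) n :
  `|p| <= 2^-1 -> `|p ^+ n.+1| <= 2^-1.
Proof.
move=> hp; rewrite normrX exprS; apply: (le_trans _ hp).
by rewrite ler_piMr// exprn_ile1//; lra.
Qed.

Lemma qpoch_neq0 (R : realType) (p : R) n : `|p| <= 2^-1 -> qpoch p p n != 0.
Proof.
move=> hp; rewrite /qpoch prodf_seq_neq0; apply/allP => j _ /=.
rewrite -exprS; have := norm_exprS_half j hp; rewrite ler_norml => h.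
by apply/eqP; lra.
Qed.

Lemma rr_term0 (R : realType) (p x : R) : rr_term p x 0%N = 1.
Proof. by rewrite /rr_term /qpoch big_ord0 !expr0 invr1 !mulr1. Qed.

(** The first-order recursion of the coefficients, multiplied out so that the
    functional equation follows termwise: 1 - p^(n+1) is the effect on the
    term of degree n + 1 of subtracting F(xp) from F(x). *)
Lemma rr_termS (R : realType) (p x : R) n : `|p| <= 2^-1 ->
  rr_term p x n.+1 * (1 - p ^+ n.+1) = x * p ^+ n.*2.+1 * rr_term p x n.
Proof.
move=> hp; rewrite /rr_term qpochS -exprS.
have h0 := qpoch_neq0 n hp.
have h1 : 1 - p ^+ n.+1 != 0.
  by have := norm_exprS_half n hp; rewrite ler_norml => h; apply/eqP; lra.
have -> : (n.+1 ^ 2 = n.*2.+1 + n ^ 2)%N by rewrite -!mulnn -addnn; lia.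
rewrite exprD [x ^+ _]exprS; field; exact/andP.
Qed.

(** Passing from n to n + 1 multiplies the term by x p^(2n+1) / (1 - p^(n+1)),
    where the power of p is at most 1/2 and the denominator at least 1/2. *)
Lemma rr_term_le (R : realType) (p x : R) n :
  `|p| <= 2^-1 -> `|rr_term p x n| <= `|x| ^+ n.
Proof.
move=> hp; elim: n => [|n IH]; first by rewrite rr_term0 normr1 expr0.
have E : `|rr_term p x n.+1| * `|1 - p ^+ n.+1| =
    `|x| * `|rr_term p x n| * `|p ^+ n.*2.+1|.
  by rewrite -!normrM rr_termS// mulrAC.
have h1 := norm_exprS_half n hp.
have h2 : `|p ^+ n.*2.+1| <= 2^-1 by exact: norm_exprS_half.
have h3 : 2^-1 <= `|1 - p ^+ n.+1|.
  by have := lerB_dist 1 (p ^+ n.+1); rewrite normr1; lra.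
rewrite exprS.
have x0 := normr_ge0 x.
have t0 := normr_ge0 (rr_term p x n).
have t1 := normr_ge0 (rr_term p x n.+1).
have q0 := normr_ge0 (p ^+ n.*2.+1).
have xt : `|x| * `|rr_term p x n| <= `|x| * `|x| ^+ n by exact: ler_wpM2l.
have xt0 : 0 <= `|x| * `|rr_term p x n| by exact: mulr_ge0.
have := ler_wpM2l xt0 h2; have := ler_wpM2l t1 h3; rewrite E; lra.
Qed.

(** An exact identity of partial sums: it gives both the functional equation
    and the convergence of the series at points x with only |x p| < 1. *)
Lemma rr_series_fe (R : realType) (p x : R) n : `|p| <= 2^-1 ->
  series (rr_term p x) n.+1 =
  series (rr_term p (x * p)) n.+1 + x * p * series (rr_term p (x * p ^+ 2)) n.
Proof.
move=> hp; elim: n => [|n IH].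
  by rewrite /series /= !big_nat1 big_geq// mulr0 addr0 !rr_term0.
have serS (v : nat -> R) k : series v k.+1 = series v k + v k.
  by rewrite /series /= big_nat_recr.
rewrite serS IH [series (rr_term p (x * p)) n.+2]serS.
rewrite [series (rr_term p (x * p ^+ 2)) n.+1]serS.
have scale k : rr_term p (x * p) k = p ^+ k * rr_term p x k.
  rewrite /rr_term exprMn.
  by move: (p ^+ _) (x ^+ _) (p ^+ _) (_^-1) => b d e f; ring.
have scale2 k : rr_term p (x * p ^+ 2) k = p ^+ k.*2 * rr_term p x k.
  rewrite /rr_term exprMn -exprM mul2n.
  by move: (p ^+ _) (x ^+ _) (p ^+ _) (_^-1) => b d e f; ring.
have := rr_termS x n hp; rewrite scale scale2 [p ^+ n.*2.+1]exprS.
move: (rr_term p x n.+1) (rr_term p x n) (p ^+ n.+1) (p ^+ n.*2) => t1 t0 P Q E.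
have e1 : t1 = P * t1 + x * (p * Q) * t0 by rewrite -E; ring.
rewrite {1}e1; ring.
Qed.

Lemma rr_fun_cvg (R : realType) (p x : R) : `|p| <= 2^-1 -> `|x| < 1 ->
  series (rr_term p x) @ \oo --> rr_fun p x.
Proof.
move=> hp hx; apply: (@normed_cvg R R^o).
apply: (@series_le_cvg _ _ (fun n => `|x| ^+ n)) => [n|n|n|].
- exact: normr_ge0.
- by rewrite exprn_ge0.
- exact: rr_term_le.
- have -> : (fun n => `|x| ^+ n) = geometric 1 `|x|.
    by apply/funext => n; rewrite /geometric /= mul1r.
  by apply: is_cvg_geometric_series; rewrite normr_id.
Qed.

(** Away from the constant term 1 the series is dominated by the geometric
    series 1/8 + 1/8^2 + ... = 1/7. *)
Lemma rr_fun_near1 (R : realType) (p x : R) : `|p| <= 2^-1 -> `|x| <= 8^-1 ->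
  6 / 7 <= rr_fun p x <= 8 / 7.
Proof.
move=> hp hx.
have cv : series (rr_term p x) @ \oo --> rr_fun p x.
  by apply: rr_fun_cvg => //; lra.
have bd n : `|series (rr_term p x) n.+1 - 1| <= (1 - 8^-1 ^+ n) / 7.
  elim: n => [|n IH].
    by rewrite /series /= big_nat1 rr_term0 expr0 subrr normr0 mul0r.
  rewrite /series /= big_nat_recr//= -/(series _ _).
  have h1 : `|rr_term p x n.+1| <= 8^-1 ^+ n.+1.
    apply: le_trans (rr_term_le x n.+1 hp) _.
    by apply: lerXn2r => //; rewrite nnegrE; lra.
  rewrite addrAC; apply: le_trans (ler_normD _ _) _.
  apply: le_trans (lerD IH h1) _.
  by rewrite [8^-1 ^+ n.+1]exprS; lra.
have e0 n : 0 <= 8^-1 ^+ n :> R by rewrite exprn_ge0.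
apply/andP; split.
  apply: (cvgr_to_ge cv); near=> n.
  have -> : n = n.-1.+1 by rewrite prednK//; near: n; exact: nbhs_infty_gt.
  by have := bd n.-1; have := e0 n.-1; rewrite ler_norml; lra.
apply: (cvgr_to_le cv); near=> n.
have -> : n = n.-1.+1 by rewrite prednK//; near: n; exact: nbhs_infty_gt.
by have := bd n.-1; have := e0 n.-1; rewrite ler_norml; lra.
Unshelve. all: by end_near.
Qed.

(** Comparison with a geometric series would need |x| < 1, but the numerators
    of the theorem are series at x = r/s or -r/s, which may be large; only
    |x p| is known to be small. *)
Lemma rr_series_cvg_fe (R : realType) (p x : R) :
  `|p| <= 2^-1 -> `|x * p| < 1 ->
  series (rr_term p x) @ \oo -->
    rr_fun p (x * p) + x * p * rr_fun p (x * p ^+ 2).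
Proof.
move=> hp hxp.
have hxp2 : `|x * p ^+ 2| < 1.
  rewrite expr2 mulrA normrM.
  by have := normr_ge0 p; have := normr_ge0 (x * p); nra.
rewrite -(cvg_shiftS (series (rr_term p x))).
under eq_fun do rewrite rr_series_fe//.
apply: cvgD.
  by rewrite (cvg_shiftS (series (rr_term p (x * p)))); exact: rr_fun_cvg.
by apply: cvgMr; exact: rr_fun_cvg.
Qed.

Lemma rr_fun_fe (R : realType) (p x : R) : `|p| <= 2^-1 -> `|x| < 1 ->
  rr_fun p x = rr_fun p (x * p) + x * p * rr_fun p (x * p ^+ 2).
Proof.
move=> hp hx; apply: cvg_unique (rr_fun_cvg hp hx) _ => //.
apply: rr_series_cvg_fe => //; rewrite normrM.
by have := normr_ge0 p; have := normr_ge0 x; nra.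
Qed.

(** The quotient w_(k+1) of the introductory comment: the index is shifted so
    that block k + 1 of the continued fraction relates rr_quot k and
    rr_quot k.+1. *)
Definition rr_quot (R : realType) (p x : R) (k : nat) : R :=
  x * p ^+ k.+1 * rr_fun p (x * p ^+ (2 * k.+1)) /
  rr_fun p (x * p ^+ (2 * k).+1).

Section Quot.
Variables (R : realType) (p x : R).
Hypotheses (hp : `|p| <= 2^-1) (hx : `|x * p| <= 8^-1).

Lemma norm_shift_le k : `|x * p ^+ k.+1| <= `|x * p|.
Proof.
rewrite exprS mulrA normrM ler_piMr// normrX exprn_ile1//.
by apply: (le_trans hp); lra.
Qed.

Lemma rr_quot_le k : `|rr_quot p x k| <= 4 / 3 * `|x * p|.
Proof.
have b j : 6 / 7 <= rr_fun p (x * p ^+ j.+1) <= 8 / 7.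
  by apply: rr_fun_near1 => //; apply: le_trans (norm_shift_le j) hx.
rewrite /rr_quot normrM normfV normrM.
have -> : (2 * k.+1 = (2 * k).+2)%N by lia.
have := b (2 * k)%N; have := b (2 * k).+1.
set f := rr_fun _ _; set g := rr_fun _ _ => hf hg.
rewrite (@ger0_norm _ f); last by lra.
rewrite (@ger0_norm _ g); last by lra.
rewrite ler_pdivrMr; last by lra.
by have := norm_shift_le k; have := normr_ge0 (x * p ^+ k.+1); nra.
Qed.

(** Two consecutive instances of the functional equation, at x p^(2k+1) and at
    x p^(2k+2), each divided by its leading term. *)
Lemma rr_quot_rec k : x != 0 -> p != 0 ->
  rr_quot p x k = ((x * p ^+ k.+1)^-1 +
                   ((p ^+ k.+1)^-1 + rr_quot p x k.+1)^-1)^-1.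
Proof.
move=> x0 p0.
have b j : 6 / 7 <= rr_fun p (x * p ^+ j.+1) <= 8 / 7.
  by apply: rr_fun_near1 => //; apply: le_trans (norm_shift_le j) hx.
have fe j : rr_fun p (x * p ^+ j.+1) = rr_fun p (x * p ^+ j.+2) +
    x * p ^+ j.+2 * rr_fun p (x * p ^+ j.+3).
  rewrite rr_fun_fe//; last first.
    by apply: (le_lt_trans (norm_shift_le j)); have := hx; lra.
  by rewrite -!(mulrA x) -exprSr -exprD addn2.
have := b (2 * k)%N; have := b (2 * k).+1.
have := b (2 * k).+2; have := b (2 * k).+3.
have := fe (2 * k).+1; have := fe (2 * k)%N.
rewrite /rr_quot.
have -> : (2 * k.+1 = (2 * k).+2)%N by lia.
have -> : (2 * k.+2 = (2 * k).+4)%N by lia.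
have -> : p ^+ (2 * k).+2 = p ^+ k.+1 * p ^+ k.+1.
  by rewrite -exprD; congr (_ ^+ _); lia.
have -> : p ^+ (2 * k).+3 = p ^+ k.+1 * p ^+ k.+2.
  by rewrite -exprD; congr (_ ^+ _); lia.
have P0 : p ^+ k.+1 != 0 by rewrite expf_neq0.
move: P0; rewrite (exprS p k.+1).
set P := p ^+ k.+1; set f1 := rr_fun _ (x * p ^+ (2 * k).+1).
set f2 := rr_fun _ (x * (P * P)).
set f3 := rr_fun _ (x * (P * (p * P))); set f4 := rr_fun _ _.
move=> P0 e1 e2 h4 h3 h2 h1.
have f10 : f1 != 0 by apply/eqP; lra.
have f20 : f2 != 0 by apply/eqP; lra.
have f30 : f3 != 0 by apply/eqP; lra.
have -> : P^-1 + x * (p * P) * f4 / f3 = f2 / (P * f3).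
  by rewrite e2; field; do ?[apply/andP; split].
have -> : (x * P)^-1 + (f2 / (P * f3))^-1 = f1 / (x * P * f2).
  by rewrite e1; field; do ?[apply/andP; split].
by rewrite invf_div.
Qed.
End Quot.

(** Dividing F(x) = F(xp) + xp F(xp^2) by F(xp) leaves 1 plus the first
    quotient. *)
Lemma rr_ratio (R : realType) (p x : R) : `|p| <= 2^-1 -> `|x * p| <= 8^-1 ->
  exists N D : R, [/\ series (rr_term p x) @ \oo --> N,
    series (rr_term p (x * p)) @ \oo --> D, D != 0 &
    N / D = 1 + rr_quot p x 0].
Proof.
move=> hp hx.
have hD : rr_fun p (x * p) != 0.
  by apply/eqP; have := rr_fun_near1 hp hx; lra.
exists (rr_fun p (x * p) + x * p * rr_fun p (x * p ^+ 2)), (rr_fun p (x * p)).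
split=> //.
- by apply: rr_series_cvg_fe => //; apply: (le_lt_trans hx); lra.
- by apply: rr_fun_cvg => //; apply: (le_lt_trans hx); lra.
- by rewrite mulrDl mulfV// /rr_quot !expr1.
Qed.

(** * Folding the blocks of partial quotients *)

Lemma inv_1_inv_pred (R : realType) (y : R) : 1 < y ->
  (1 + (y - 1)^-1)^-1 = 1 - y^-1.
Proof. move=> y1; field; repeat (apply/andP; split); apply/eqP; lra. Qed.

(** Conjugated by the translation by 1/m, the Moebius map y |-> 1/(m - 1/y)
    becomes v |-> 1/(m^2 v). *)
Lemma invert_minus (R : realType) (m v : R) : m != 0 -> v != 0 ->
  v + m^-1 != 0 -> (m - (v + m^-1)^-1)^-1 = m^-1 + (m ^+ 2 * v)^-1.
Proof.
move=> m0 v0 h.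
have h' : m * v + 1 != 0.
  by apply: contra_neq h => e; apply: (mulfI m0); rewrite mulr0 mulrDr mulfV.
have -> : m - (v + m^-1)^-1 = (m ^+ 2 * v) / (m * v + 1).
  by field; apply/andP.
by field; apply/and3P.
Qed.

(** The previous rule with m replaced by - m. *)
Lemma invert_plus (R : realType) (m v : R) : m != 0 -> v != 0 ->
  v - m^-1 != 0 -> (m + (v - m^-1)^-1)^-1 = m^-1 - (m ^+ 2 * v)^-1.
Proof.
move=> m0 v0 h; have := @invert_minus R (- m) v.
rewrite oppr_eq0 invrN => /(_ m0 v0 h) e.
by apply: oppr_inj; rewrite -[LHS]invrN opprD e sqrrN opprB addrC.
Qed.

Lemma inv_range (R : realType) (y : R) : 1 <= y -> 0 < y^-1 <= 1.
Proof. by move=> y1; rewrite invr_gt0 invf_le1; lra. Qed.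

Lemma mulr_addV (R : realType) (c x y : R) : c != 0 ->
  c * (x + (c * y)^-1) = c * x + y^-1.
Proof. by move=> c0; rewrite mulrDr invfM mulVKf. Qed.

Lemma mulr_subV (R : realType) (c x y : R) : c != 0 ->
  c * (x - (c * y)^-1) = c * x - y^-1.
Proof. by move=> c0; rewrite mulrBr invfM mulVKf. Qed.

Section Blocks.
Variable R : realType.
Implicit Types (X Y : int) (t : R).

(** The way to eliminate a pair 1, Y - 1: it adds 1 to the partial quotient on
    its left and continues the fraction with a minus sign. *)
Lemma cf_cons1 Y t : 1 < Y%:~R + t ->
  cf_cons 1 (cf_cons (Y - 1) t) = 1 - (Y%:~R + t)^-1.
Proof. by move=> h; rewrite /cf_cons intrB addrAC inv_1_inv_pred. Qed.

Lemma cf_cons_minus (m : int) Y t : 1 < Y%:~R + t ->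
  cf_cons (m - 1) (cf_cons 1 (cf_cons (Y - 1) t)) =
  (m%:~R - (Y%:~R + t)^-1)^-1.
Proof. by move=> h; rewrite cf_cons1// /cf_cons intrB addrA subrK. Qed.

Lemma cf_cons_1_minus (m : int) Y t : 2 < m -> 1 < Y%:~R + t ->
  cf_cons 1 (cf_cons (m - 2) (cf_cons 1 (cf_cons (Y - 1) t))) =
  1 - (m%:~R - (Y%:~R + t)^-1)^-1.
Proof.
move=> m2 h; rewrite cf_cons1//.
have m3 : 3 <= m%:~R :> R by rewrite -[3]/(3%:~R) ler_int.
have := inv_range (ltW h).
set V := (_ + _)^-1 => V1.
rewrite -inv_1_inv_pred; last by lra.
by rewrite /cf_cons intrB -[2%:~R]/(2 : R); congr ((_ + _^-1)^-1); ring.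
Qed.

Variables (m : int) (w : R).
Local Notation M := (m%:~R : R).
Hypotheses (m1 : 1 < m) (hw : `|w| <= 1 / 2).

Lemma m_ge2 : 2 <= M. Proof. by rewrite -[2]/(2%:~R) ler_int. Qed.

Lemma m_neq0 : M != 0. Proof. by apply/eqP; have := m_ge2; lra. Qed.

Lemma inv_m_range : 0 < M^-1 <= 1 / 2.
Proof. by have m2 := m_ge2; rewrite invr_gt0 div1r lef_pV2 ?posrE; lra. Qed.

Lemma int_ge2 Y : 2 <= Y -> 2 <= Y%:~R :> R.
Proof. by move=> Y2; rewrite -[2]/(2%:~R) ler_int. Qed.

Lemma inv_small (y : R) : 1 <= y -> 0 < (M ^+ 2 * y)^-1 <= 1 / 4.
Proof.
move=> y1; have m2 := m_ge2; have m4 : 4 <= M ^+ 2 by nra.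
by rewrite invr_gt0 div1r lef_pV2 ?posrE; nra.
Qed.

Lemma w_range : - (1 / 2) <= w <= 1 / 2. Proof. by rewrite -ler_norml. Qed.

(** In this lemma and the next three, the block is folded from its right end:
    the half that contains Y yields the small quantity u = 1/(m^2 (Y + w)), and
    this is the correction to X in the half that contains X. *)
Lemma block1_fold X Y : 2 <= X -> 2 <= Y ->
  foldr (@cf_cons R) (M^-1 + w) [:: m - 1; 1; X - 1; m - 1; 1; Y - 1] =
  M^-1 + (M ^+ 2 * X%:~R + (Y%:~R + w)^-1)^-1.
Proof.
move=> /int_ge2 hX /int_ge2 hY /=.
have mge2 := m_ge2; have mn0 := m_neq0.
have mi := inv_m_range; have hw' := w_range.
rewrite (cf_cons_minus m (Y := Y)); last by lra.
rewrite addrA addrAC invert_minus//; try by apply/eqP; lra.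
have /inv_small : 1 <= Y%:~R + w by lra.
set u := (M ^+ 2 * _)^-1 => hu.
rewrite cf_cons_minus; last by lra.
rewrite addrA addrAC invert_minus//; try by apply/eqP; lra.
by rewrite /u mulr_addV ?expf_neq0//.
Qed.

Lemma block2_fold X Y : 2 < m -> 2 <= X -> 2 <= Y ->
  foldr (@cf_cons R) (M^-1 + w) [:: m; X - 1; 1; m - 2; 1; Y - 1] =
  M^-1 + (- (M ^+ 2 * X%:~R) + (Y%:~R + w)^-1)^-1.
Proof.
move=> m2 /int_ge2 hX /int_ge2 hY /=.
have mge2 := m_ge2; have mn0 := m_neq0.
have mi := inv_m_range; have hw' := w_range.
rewrite cf_cons_1_minus//; last by lra.
rewrite addrA addrAC invert_minus//; try by apply/eqP; lra.
have /inv_small : 1 <= Y%:~R + w by lra.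
set u := (M ^+ 2 * _)^-1 => hu.
have -> : cf_cons (X - 1) (1 - (M^-1 + u)) = (X%:~R - u - M^-1)^-1.
  by rewrite /cf_cons intrB; congr (_^-1); ring.
rewrite /cf_cons invert_plus//; try by apply/eqP; lra.
rewrite -[X in _ + X = _]invrN; congr (_ + _^-1).
by rewrite /u mulr_subV ?expf_neq0// opprB addrC.
Qed.

Lemma block3_fold X Y : 2 < m -> 2 <= X -> 2 <= Y ->
  foldr (@cf_cons R) (1 - M^-1 + w) [:: 1; m - 2; 1; X - 1; m; Y - 1] =
  1 - M^-1 + (- (M ^+ 2 * X%:~R) + (Y%:~R + w)^-1)^-1.
Proof.
move=> m2 /int_ge2 hX /int_ge2 hY /=.
have mge2 := m_ge2; have mn0 := m_neq0.
have mi := inv_m_range; have hw' := w_range.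
have -> : cf_cons (Y - 1) (1 - M^-1 + w) = (Y%:~R + w - M^-1)^-1.
  by rewrite /cf_cons intrB; congr (_^-1); ring.
have -> : cf_cons m (Y%:~R + w - M^-1)^-1 = M^-1 - (M ^+ 2 * (Y%:~R + w))^-1.
  by rewrite /cf_cons invert_plus//; apply/eqP; lra.
have /inv_small : 1 <= Y%:~R + w by lra.
set u := (M ^+ 2 * _)^-1 => hu.
rewrite cf_cons_1_minus//; last by lra.
rewrite addrA addrAC invert_minus//; try by apply/eqP; lra.
rewrite opprD addrA -[X in _ + X = _]invrN; congr (_ + _^-1).
by rewrite /u mulr_subV ?expf_neq0// opprB addrC.
Qed.

(** The first and last halves of this long block are folded with opposite
    signs, which is what the base -1/a in the last identity requires. *)
Lemma block4_fold X1 Y1 X2 Y2 :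
  2 < m -> 2 <= X1 -> 2 <= Y1 -> 2 <= X2 -> 2 <= Y2 ->
  foldr (@cf_cons R) (M^-1 + w)
    [:: m; X1 - 1; 1; m - 1; Y1 - 1; 1; m - 2; 1; X2 - 1; m - 1; 1; Y2 - 1] =
  M^-1 + (- (M ^+ 2 * X1%:~R) +
          (- Y1%:~R + (M ^+ 2 * X2%:~R + (Y2%:~R + w)^-1)^-1)^-1)^-1.
Proof.
move=> m2 /int_ge2 hX1 /int_ge2 hY1 /int_ge2 hX2 /int_ge2 hY2 /=.
have mge2 := m_ge2; have mn0 := m_neq0.
have mi := inv_m_range; have hw' := w_range.
rewrite (cf_cons_minus m (Y := Y2)); last by lra.
rewrite addrA addrAC invert_minus//; try by apply/eqP; lra.
have /inv_small : 1 <= Y2%:~R + w by lra.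
set u := (M ^+ 2 * _)^-1 => hu.
rewrite cf_cons_1_minus//; last by lra.
rewrite [_ + (_ + u)]addrA [_ + _ + u]addrAC invert_minus//;
  try by apply/eqP; lra.
have -> : M ^+ 2 * (X2%:~R + u) = M ^+ 2 * X2%:~R + (Y2%:~R + w)^-1.
  by rewrite /u mulr_addV ?expf_neq0//.
set w2 := (_ + _)^-1.
have hw2 : 0 < w2 <= 1 / 4.
  have i0 : 0 < (Y2%:~R + w)^-1 by rewrite invr_gt0; lra.
  have m4 : 4 <= M ^+ 2 by nra.
  have h4 : 4 <= M ^+ 2 * X2%:~R by nra.
  by rewrite /w2 invr_gt0 div1r lef_pV2 ?posrE; lra.
have -> : cf_cons (Y1 - 1) (1 - (M^-1 + w2)) = (Y1%:~R - w2 - M^-1)^-1.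
  by rewrite /cf_cons intrB; congr (_^-1); ring.
rewrite cf_cons1; last first.
  have : 0 < (Y1%:~R - w2 - M^-1)^-1 by rewrite invr_gt0; lra.
  by lra.
rewrite invert_plus//; try by apply/eqP; lra.
have /inv_small : 1 <= Y1%:~R - w2 by lra.
set u1 := (M ^+ 2 * _)^-1 => hu1.
have -> : cf_cons (X1 - 1) (1 - (M^-1 - u1)) = (X1%:~R + u1 - M^-1)^-1.
  by rewrite /cf_cons intrB; congr (_^-1); ring.
rewrite /cf_cons invert_plus//; try by apply/eqP; lra.
rewrite -[X in _ + X = _]invrN; congr (_ + _^-1).
rewrite /u1 mulr_addV ?expf_neq0// opprD -[X in _ + X = _]invrN.
by rewrite opprB [w2 - _]addrC.
Qed.
End Blocks.

(** * The tails of the four continued fractions *)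

Section Tails.
Variables (R : realType) (m r s a : nat).
Hypotheses (m_gt1 : (1 < m)%N) (r_gt0 : (0 < r)%N) (s_gt0 : (0 < s)%N).
Hypotheses (a_gt1 : (1 < a)%N) (dvd_sa : (r * m ^ 2 %| s * a)%N).
Hypothesis X1_gt1 : (1 < (s * a) %/ (r * m ^ 2))%N.
Local Notation c := (r%:R / s%:R : R).
Local Notation X k := ((s * a ^ k) %/ (r * m ^ 2))%N.

(** The reason for the factor m^2 in the statement: folding multiplies the
    partial quotient X k by m^2, which restores a^k s / r. *)
Lemma scaled_quotient k : (m%:R ^+ 2 * (X k.+1)%:R : R) = c^-1 * a%:R ^+ k.+1.
Proof.
have dv : (r * m ^ 2 %| s * a ^ k.+1)%N by rewrite (expnS a) mulnA dvdn_mulr.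
have := congr1 (fun n : nat => n%:R : R) (divnK dv).
rewrite /= !natrM !natrX => E.
have r0 : r%:R != 0 :> R by rewrite pnatr_eq0 -lt0n.
have -> : c^-1 * a%:R ^+ k.+1 = s%:R * a%:R ^+ k.+1 / r%:R :> R.
  by rewrite invf_div mulrAC.
by rewrite -E; field.
Qed.

Lemma quotient_ge2 k : (2 <= X k.+1)%N.
Proof.
apply: leq_trans X1_gt1 _; apply: leq_div2r.
by rewrite leq_mul2l expnS leq_pmulr ?orbT// expn_gt0 (ltnW a_gt1).
Qed.

Lemma pow_ge2 k : (2 <= a ^ k.+1)%N.
Proof.
by rewrite (leq_trans a_gt1)// expnS leq_pmulr// expn_gt0 (ltnW a_gt1).
Qed.

(* The four identities differ in the signs of x and p only, so the estimates
   are made from the absolute values. *)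
Variables x p : R.
Hypotheses (hx : `|x| = c) (hp : `|p| = a%:R^-1).

Lemma base_le : `|p| <= 2^-1.
Proof. by rewrite hp lef_pV2 ?posrE ?ltr0n ?ler_nat// ltnW. Qed.

Lemma base_neq0 : p != 0.
Proof. by rewrite -normr_eq0 hp invr_eq0 pnatr_eq0 -lt0n ltnW. Qed.

Lemma arg_neq0 : x != 0.
Proof. by rewrite -normr_eq0 hx mulf_neq0// ?invr_eq0 pnatr_eq0 -lt0n. Qed.

(** Here |x p| = r / (s a) = 1 / (m^2 X 1), and X 1 >= 2 by hypothesis. *)
Lemma arg_le_m : m%:R ^+ 2 * `|x * p| <= 2^-1.
Proof.
rewrite normrM hx hp; have := scaled_quotient 0; rewrite expr1 => E.
have := quotient_ge2 0; rewrite -(ler_nat R) => h2.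
have m0 : 0 < m%:R :> R by rewrite ltr0n ltnW.
have r0 : 0 < r%:R :> R by rewrite ltr0n.
have s0 : 0 < s%:R :> R by rewrite ltr0n.
have a0 : 0 < a%:R :> R by rewrite ltr0n ltnW.
have -> : m%:R ^+ 2 * (c / a%:R) = (X 1)%:R^-1.
  have -> : c / a%:R = (c^-1 * a%:R)^-1 by rewrite invfM invrK.
  by rewrite -E; field; rewrite !gt_eqF//; lra.
by rewrite lef_pV2 ?posrE//; lra.
Qed.

Lemma arg_le : `|x * p| <= 8^-1.
Proof.
have := arg_le_m; have := normr_ge0 (x * p).
move: m_gt1; rewrite -(ler_nat R) => m2 t0 ht.
have m4 : 0 <= m%:R ^+ 2 - 4 :> R by nra.
by have := mulr_ge0 m4 t0; lra.
Qed.

(** This makes the tails 1/m + w and 1 - 1/m + w nonnegative, whatever the sign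
    of w. *)
Lemma quot_le k : `|rr_quot p x k| <= m%:R^-1.
Proof.
apply: le_trans (rr_quot_le base_le arg_le k) _.
have := arg_le_m; have := normr_ge0 (x * p).
move: m_gt1; rewrite -(ler_nat R) => m2 h0 h1.
rewrite -[leRHS]mul1r ler_pdivlMr; last by lra.
have : 0 <= `|x * p| * m%:R * (m%:R - 2) by rewrite !mulr_ge0//; lra.
lra.
Qed.

Lemma quot_le_half k : `|rr_quot p x k| <= 1 / 2.
Proof.
apply: le_trans (quot_le k) _; rewrite div1r lef_pV2 ?posrE ?ler_nat//.
by rewrite ltr0n ltnW.
Qed.

Lemma quot_rec k : rr_quot p x k = ((x * p ^+ k.+1)^-1 +
                   ((p ^+ k.+1)^-1 + rr_quot p x k.+1)^-1)^-1.
Proof. exact: rr_quot_rec base_le arg_le k arg_neq0 base_neq0. Qed.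

Lemma inv_pos_pow k : p = a%:R^-1 -> (p ^+ k)^-1 = (a ^ k)%N%:R.
Proof. by move=> ->; rewrite exprVn invrK natrX. Qed.

Lemma block1_cf : p = a%:R^-1 -> x = c ->
  is_regular_cf
    (block_seq 0 (fun k => [tuple m%:Z - 1; 1; (X k)%:Z - 1;
                                  m%:Z - 1; 1; (a ^ k)%N%:Z - 1]))
    (1 / m%:R + rr_quot p x 0).
Proof.
move=> pE xE; rewrite -[1 / _]add0r -addrA div1r.
apply: (@regular_cf_blocks R 6 0 _ (fun k => m%:R^-1 + rr_quot p x k)) => //.
- move=> k /=; have := quotient_ge2 k; have := pow_ge2 k.
  by move: m_gt1 (a ^ _)%N (X _) => m1 y z; lia.
- by move=> k; have := quot_le k; rewrite ler_norml; lra.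
move=> k; rewrite (@block1_fold R m%:Z) ?quot_le_half ?lez_nat ?ltz_nat
  ?quotient_ge2 ?pow_ge2//.
rewrite [in LHS]quot_rec inv_pos_pow// invfM inv_pos_pow// xE -!pmulrn !natrX.
by rewrite -scaled_quotient.
Qed.

Lemma block2_cf : p = a%:R^-1 -> x = - c -> (2 < m)%N ->
  is_regular_cf
    (block_seq 1 (fun k => [tuple m%:Z; (X k)%:Z - 1; 1;
                                  m%:Z - 2; 1; (a ^ k)%N%:Z - 1]))
    (1 / m%:R + (1 + rr_quot p x 0)).
Proof.
move=> pE xE m_gt2; rewrite addrCA div1r.
apply: (@regular_cf_blocks R 6 1 _ (fun k => m%:R^-1 + rr_quot p x k)) => //.
- move=> k /=; have := quotient_ge2 k; have := pow_ge2 k.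
  by move: m_gt2 (a ^ _)%N (X _) => m1 y z; lia.
- by move=> k; have := quot_le k; rewrite ler_norml; lra.
move=> k; rewrite (@block2_fold R m%:Z) ?quot_le_half ?lez_nat ?ltz_nat
  ?quotient_ge2 ?pow_ge2//.
rewrite [in LHS]quot_rec inv_pos_pow// invfM inv_pos_pow// xE -!pmulrn !natrX.
by rewrite invrN mulNr -scaled_quotient.
Qed.

Lemma block3_cf : p = a%:R^-1 -> x = - c -> (2 < m)%N ->
  is_regular_cf
    (block_seq 0 (fun k => [tuple 1; m%:Z - 2; 1; (X k)%:Z - 1; m%:Z;
                                  (a ^ k)%N%:Z - 1]))
    (- 1 / m%:R + (1 + rr_quot p x 0)).
Proof.
move=> pE xE m_gt2.
have -> : - 1 / m%:R + (1 + rr_quot p x 0) =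
    0%:~R + (1 - m%:R^-1 + rr_quot p x 0) by rewrite mulN1r add0r; ring.
apply: (@regular_cf_blocks R 6 0 _
  (fun k => 1 - m%:R^-1 + rr_quot p x k)) => //.
- move=> k /=; have := quotient_ge2 k; have := pow_ge2 k.
  by move: m_gt2 (a ^ _)%N (X _) => m1 y z; lia.
- move=> k; have := quot_le_half k; have : m%:R^-1 <= 2^-1 :> R.
    by rewrite lef_pV2 ?posrE ?ler_nat ?ltr0n// ltnW.
  by rewrite ler_norml; lra.
move=> k; rewrite (@block3_fold R m%:Z) ?quot_le_half ?lez_nat ?ltz_nat
  ?quotient_ge2 ?pow_ge2//.
rewrite [in LHS]quot_rec inv_pos_pow// invfM inv_pos_pow// xE -!pmulrn !natrX.
by rewrite invrN mulNr -scaled_quotient.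
Qed.

Lemma inv_neg_pow k : p = - a%:R^-1 ->
  (p ^+ k)^-1 = (-1) ^+ k * (a ^ k)%N%:R.
Proof. by move=> ->; rewrite -exprVn invrN invrK natrX -exprMn mulN1r. Qed.

(** One block of twelve covers two steps of the recursion, an odd power of -a
    and an even one, so only every other quotient is a tail. *)
Lemma block4_cf : p = - a%:R^-1 -> x = c -> (2 < m)%N ->
  is_regular_cf
    (block_seq 1 (fun k => [tuple m%:Z; (X (2 * k - 1))%:Z - 1; 1; m%:Z - 1;
                                  (a ^ (2 * k - 1))%N%:Z - 1; 1; m%:Z - 2; 1;
                                  (X (2 * k))%:Z - 1; m%:Z - 1; 1;
                                  (a ^ (2 * k))%N%:Z - 1]))
    (1 / m%:R + (1 + rr_quot p x 0)).
Proof.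
move=> pE xE m_gt2; rewrite addrCA div1r.
have E1 k : (2 * k.+1 - 1 = (2 * k).+1)%N by lia.
have E2 k : (2 * k.+1 = (2 * k).+2)%N by lia.
apply: (@regular_cf_blocks R 12 1 _
  (fun k => m%:R^-1 + rr_quot p x (2 * k))) => //.
- move=> k; rewrite E1 E2 /=.
  have := quotient_ge2 (2 * k); have := pow_ge2 (2 * k).
  have := quotient_ge2 (2 * k).+1; have := pow_ge2 (2 * k).+1.
  move: m_gt2 (a ^ (2 * k).+1)%N (X (2 * k).+1).
  move=> m2 y1 z1; move: (a ^ (2 * k).+2)%N (X (2 * k).+2) => y2 z2.
  by lia.
- by move=> k; have := quot_le (2 * k); rewrite ler_norml; lra.
move=> k; rewrite E1 E2.
rewrite (@block4_fold R m%:Z) ?quot_le_half ?lez_nat ?ltz_nat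
  ?quotient_ge2 ?pow_ge2//.
have odd_sign : (-1) ^+ (2 * k).+1 = -1 :> R.
  by rewrite -signr_odd mul2n /= odd_double expr1.
have even_sign : (-1) ^+ (2 * k).+2 = 1 :> R.
  by rewrite -signr_odd mul2n /= odd_double expr0.
rewrite [in LHS]quot_rec [in LHS]quot_rec !(invfM x) !inv_neg_pow//.
rewrite odd_sign even_sign !mul1r !mulN1r mulrN xE -!pmulrn !natrX.
by rewrite -!scaled_quotient.
Qed.
End Tails.

(** * The four identities *)

(* Since r * m ^ 2 divides s * a, the nat quotients below are all exact. *)
Theorem theorem4 (R : realType) (m r s a : nat)
    (m_gt0 : (0 < m)%N) (r_gt0 : (0 < r)%N) (s_gt0 : (0 < s)%N)
    (a_gt1 : (1 < a)%N) (dvd_sa : (r * m ^ 2 %| s * a)%N) :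
  [/\ (1 < m)%N -> (1 < (s * a) %/ (r * m ^ 2))%N ->
      exists N D : R,
        [/\ series (fun n => (r%:R / s%:R) ^+ n.+1 /
              (a%:R ^+ (n.+1 ^ 2) * qpoch (1 / a%:R) (1 / a%:R) n))
              @ \oo --> N,
            series (fun n => (r%:R / s%:R) ^+ n /
              (a%:R ^+ (n ^ 2 + n) * qpoch (1 / a%:R) (1 / a%:R) n))
              @ \oo --> D,
            D != 0 &
            is_regular_cf
              (block_seq 0 (fun k =>
                [tuple m%:Z - 1; 1; ((s * a ^ k) %/ (r * m ^ 2))%N%:Z - 1;
                       m%:Z - 1; 1; (a ^ k)%N%:Z - 1]))
              (1 / m%:R + N / D)],

      (2 < m)%N -> (1 < (s * a) %/ (r * m ^ 2))%N ->
      exists N D : R,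
        [/\ series (fun n => (- r%:R / s%:R) ^+ n /
              (a%:R ^+ (n ^ 2) * qpoch (1 / a%:R) (1 / a%:R) n))
              @ \oo --> N,
            series (fun n => (- r%:R / s%:R) ^+ n /
              (a%:R ^+ (n ^ 2 + n) * qpoch (1 / a%:R) (1 / a%:R) n))
              @ \oo --> D,
            D != 0 &
            is_regular_cf
              (block_seq 1 (fun k =>
                [tuple m%:Z; ((s * a ^ k) %/ (r * m ^ 2))%N%:Z - 1; 1;
                       m%:Z - 2; 1; (a ^ k)%N%:Z - 1]))
              (1 / m%:R + N / D)],

      (2 < m)%N -> (1 < (s * a) %/ (r * m ^ 2))%N ->
      exists N D : R,
        [/\ series (fun n => (- r%:R / s%:R) ^+ n /
              (a%:R ^+ (n ^ 2) * qpoch (1 / a%:R) (1 / a%:R) n))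
              @ \oo --> N,
            series (fun n => (- r%:R / s%:R) ^+ n /
              (a%:R ^+ (n ^ 2 + n) * qpoch (1 / a%:R) (1 / a%:R) n))
              @ \oo --> D,
            D != 0 &
            is_regular_cf
              (block_seq 0 (fun k =>
                [tuple 1; m%:Z - 2; 1;
                       ((s * a ^ k) %/ (r * m ^ 2))%N%:Z - 1; m%:Z;
                       (a ^ k)%N%:Z - 1]))
              (- 1 / m%:R + N / D)] &

      (2 < m)%N -> (1 < (s * a) %/ (r * m ^ 2))%N ->
      exists N D : R,
        [/\ series (fun n => (- r%:R / s%:R) ^+ n /
              (a%:R ^+ (n ^ 2) * qpoch (- 1 / a%:R) (- 1 / a%:R) n))
              @ \oo --> N,
            series (fun n => (r%:R / s%:R) ^+ n /
              (a%:R ^+ (n ^ 2 + n) * qpoch (- 1 / a%:R) (- 1 / a%:R) n))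
              @ \oo --> D,
            D != 0 &
            is_regular_cf
              (block_seq 1 (fun k =>
                [tuple m%:Z; ((s * a ^ (2 * k - 1)) %/ (r * m ^ 2))%N%:Z - 1; 1;
                       m%:Z - 1; (a ^ (2 * k - 1))%N%:Z - 1; 1;
                       m%:Z - 2; 1;
                       ((s * a ^ (2 * k)) %/ (r * m ^ 2))%N%:Z - 1;
                       m%:Z - 1; 1; (a ^ (2 * k))%N%:Z - 1]))
              (1 / m%:R + N / D)]].
Proof.
set c : R := r%:R / s%:R; set q : R := 1 / a%:R.
have qE : q = a%:R^-1 by rewrite /q div1r.
have c_ge0 : 0 <= c by rewrite divr_ge0.
have q_ge0 : 0 <= q by rewrite qE invr_ge0.
have nc : `|c| = c by rewrite ger0_norm.
have nNc : `|- c| = c by rewrite normrN.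
have nq : `|q| = a%:R^-1 by rewrite ger0_norm.
have nNq : `|- q| = a%:R^-1 by rewrite normrN.
have NcE : - r%:R / s%:R = - c by rewrite mulNr.
have NqE : - 1 / a%:R = - q by rewrite mulNr.
have numE (x : R) : (fun n => x ^+ n / (a%:R ^+ (n ^ 2) * qpoch q q n)) =
    rr_term q x.
  apply/funext => n; rewrite /rr_term qE exprVn invfM mulrA.
  by rewrite [_ * x ^+ n]mulrC.
have denE (x : R) :
    (fun n => x ^+ n / (a%:R ^+ (n ^ 2 + n) * qpoch q q n)) =
    rr_term q (x * q).
  apply/funext => n; rewrite /rr_term qE exprMn !exprVn exprD !invfM.
  by rewrite !mulrA [a%:R ^- (n ^ 2) * _]mulrC.
split.
- move=> m_gt1 q_gt1.
  have hp := base_le a_gt1 nq.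
  have hx := arg_le m_gt1 r_gt0 s_gt0 a_gt1 dvd_sa q_gt1 nc nq.
  have hD : rr_fun q (c * q) != 0.
    by apply/eqP; have := rr_fun_near1 hp hx; lra.
  (* The numerator is the second summand of the functional equation at c. *)
  exists (c * q * rr_fun q (c * q ^+ 2)), (rr_fun q (c * q)).
  split=> //.
  + have -> : (fun n => c ^+ n.+1 / (a%:R ^+ (n.+1 ^ 2) * qpoch q q n)) =
              (fun n => c * q * rr_term q (c * q ^+ 2) n).
      apply/funext => n; rewrite /rr_term.
      have -> : (n.+1 ^ 2 = n ^ 2 + 2 * n + 1)%N by rewrite -!mulnn; lia.
      rewrite [(c * _) ^+ n]exprMn -exprM !exprD expr1 exprS.
      rewrite !invfM -!exprVn -qE.
      by move: (q ^+ _) (q ^+ _) (c ^+ _) (_^-1) => u1 u2 u3 u4; ring.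
    have -> : series (fun n => c * q * rr_term q (c * q ^+ 2) n) =
        (fun n => c * q * series (rr_term q (c * q ^+ 2)) n).
      by apply/funext => n; rewrite /series /= mulr_sumr.
    apply: cvgMr; apply: rr_fun_cvg => //.
    have := norm_shift_le c hp 1; lra.
  + by rewrite denE; apply: rr_fun_cvg => //; lra.
  + have -> : c * q * rr_fun q (c * q ^+ 2) / rr_fun q (c * q) = rr_quot q c 0.
      by rewrite /rr_quot !expr1.
    exact: block1_cf.
- move=> m_gt2 q_gt1; have m_gt1 := ltnW m_gt2.
  have hx := arg_le m_gt1 r_gt0 s_gt0 a_gt1 dvd_sa q_gt1 nNc nq.
  have [N [D [hN hD D0 E]]] := rr_ratio (base_le a_gt1 nq) hx.
  exists N, D; rewrite NcE numE denE E; split=> //.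
  exact: block2_cf.
- move=> m_gt2 q_gt1; have m_gt1 := ltnW m_gt2.
  have hx := arg_le m_gt1 r_gt0 s_gt0 a_gt1 dvd_sa q_gt1 nNc nq.
  have [N [D [hN hD D0 E]]] := rr_ratio (base_le a_gt1 nq) hx.
  exists N, D; rewrite NcE numE denE E; split=> //.
  exact: block3_cf.
move=> m_gt2 q_gt1; have m_gt1 := ltnW m_gt2.
have hx := arg_le m_gt1 r_gt0 s_gt0 a_gt1 dvd_sa q_gt1 nc nNq.
have [N [D [hN hD D0 E]]] := rr_ratio (base_le a_gt1 nNq) hx.
exists N, D; rewrite NcE NqE E.
have -> : (fun n => (- c) ^+ n / (a%:R ^+ (n ^ 2) * qpoch (- q) (- q) n)) =
    rr_term (- q) c.
  apply/funext => n; rewrite /rr_term invfM -exprVn -qE exprNn.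
  rewrite [(- q) ^+ _]exprNn.
  (* n ^ 2 and n have the same parity. *)
  rewrite -(signr_odd R (n ^ 2)) oddX signr_odd.
  by move: (q ^+ _) (_ ^+ n) (c ^+ _) (_^-1) => u1 u2 u3 u4; ring.
have -> : (fun n => c ^+ n / (a%:R ^+ (n ^ 2 + n) * qpoch (- q) (- q) n)) =
    rr_term (- q) (c * - q).
  apply/funext => n; rewrite /rr_term invfM -exprVn -qE [(c * _) ^+ n]exprMn.
  have -> : (- q) ^+ (n ^ 2) * (c ^+ n * (- q) ^+ n) =
      c ^+ n * (- q) ^+ (n ^ 2 + n) by rewrite exprD; ring.
  (* n ^ 2 + n is even. *)
  rewrite [(- q) ^+ _]exprNn -(signr_odd R (n ^ 2 + n)) oddD oddX /= addbb.
  by rewrite expr0 mul1r mulrA.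
split=> //.
by apply: block4_cf => //; rewrite qE.
Qed.
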